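(* Let $g\in L^2(\mathbb{R},\mathrm{d}x)$ and let $$G(z)=\frac1{2\pi\mathrm{i}}\int_{\mathbb{R}}\frac{g(t)\,\mathrm{d}t}{t-z},\qquad z\in\mathbb{C}_+\cup\mathbb{C}_-,$$ be the Cauchy integral of $g$ on $\mathbb{R}$. Then, for each of the two choices of sign, $$\sup_{\tau>0}\lVert G(\cdot\pm\mathrm{i}\tau)\rVert_{L^2(\mathbb{R},\mathrm{d}x)}\leqslant 4\lVert g\rVert_{L^2(\mathbb{R},\mathrm{d}x)}.$$
   Context: $\mathbb{C}_+=\{x+\mathrm{i}y\colon x\in\mathbb{R},y>0\}$ and $\mathbb{C}_-=\{x+\mathrm{i}y\colon x\in\mathbb{R},y<0\}$. $\lVert G(\cdot\pm\mathrm{i}\tau)\rVert_{L^2(\mathbb{R},\mathrm{d}x)}=\big(\int_{\mathbb{R}}|G(x\pm\mathrm{i}\tau)|^2\,\mathrm{d}x\big)^{1/2}$. *)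

(* Defs.v *)
From mathcomp Require Import all_boot all_order all_algebra.
From mathcomp Require Import complex.
From mathcomp Require Import all_classical all_reals all_analysis.

Set Implicit Arguments.
Unset Strict Implicit.
Unset Printing Implicit Defensive.

Import Order.TTheory GRing.Theory Num.Theory.
Import numFieldNormedType.Exports.

Local Open Scope ring_scope.
Local Open Scope complex_scope.

Definition L2norm (R : realType) (h : R -> R[i]) : \bar R :=
  Lnorm (@lebesgue_measure R) 2%:E
    (fun x => (ComplexField.Normc.normc (h x))%:E).

Definition measurable_cfun (R : realType) (h : R -> R[i]) : Prop :=
  measurable_fun [set: R] (fun x => complex.Re (h x)) /\
  measurable_fun [set: R] (fun x => complex.Im (h x)).

Definition inL2 (R : realType) (h : R -> R[i]) : Prop :=
  measurable_cfun h /\ (L2norm h < +oo)%E.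

(* [Rintegral] is total, with junk values for non-integrable functions. *)
Definition cintegral (R : realType) (h : R -> R[i]) : R[i] :=
  (\int[@lebesgue_measure R]_t complex.Re (h t)) +i*
  (\int[@lebesgue_measure R]_t complex.Im (h t)).

(* Only meaningful for Im z != 0; the integrand is then integrable whenever
   g is in L^2, by Cauchy-Schwarz. *)
Definition cauchy_integral (R : realType) (g : R -> R[i]) (z : R[i]) : R[i] :=
  (2 * (pi : R)%:C * 'i%C)^-1 * cintegral (fun t => g t / (t%:C - z)).

(* Main.v *)
From HB Require Import structures.
Require Import Defs.
From mathcomp Require Import all_boot all_order all_algebra.
From mathcomp Require Import complex.
From mathcomp Require Import all_classical all_reals all_analysis.
From mathcomp Require Import measurable_realfun.
From mathcomp Require Import ring lra.

Set Implicit Arguments.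
Unset Strict Implicit.
Unset Printing Implicit Defensive.

Import Order.TTheory GRing.Theory Num.Theory.
Import numFieldNormedType.Exports.
Local Open Scope classical_set_scope.
Local Open Scope ring_scope.

(** Write [K u = (u - i y)^-1] for the Cauchy kernel.  Its imaginary part is the
    Poisson kernel [poisson y u = y / (u^2 + y^2)] and its real part is the
    conjugate kernel [conj_poisson y u = u / (u^2 + y^2)].  The conjugate kernel
    is not integrable, so Young's inequality does not bound the Cauchy integral;
    the proof is the T*T argument instead.

    For real [g], let [U x] and [V x] be the integrals of [g t] against
    [conj_poisson y (t - x)] and [poisson y (t - x)].  Expanding the squares and
    integrating over [x] first,
    [int (U^2 + V^2) = int int g(t) g(s) k(t,s) dt ds], where [k(t,s)] is the
    integral over [x] of the real part of [K (t - x) * conj (K (s - x))].  This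
    integral is elementary and equals [2 pi * poisson (2 y) (s - t)]
    ([integral_kernel_corr]): the correlation of the Cauchy kernel with itself is
    again a Poisson kernel, which is positive and has integral [pi].  Schur's
    test, that is [|g(t) g(s)| <= (g(t)^2 + g(s)^2) / 2] followed by Tonelli,
    gives [int (U^2 + V^2) <= 2 pi^2 int g^2]
    ([poisson_pair_L2_bound_integrable]).

    The exchange of integrals needs [g] integrable as well as square integrable;
    the general case follows by truncating [g] to [-n, n] and applying Fatou's
    lemma ([poisson_pair_L2_bound]).

    For complex [g = g1 + i g2], the parallelogram inequality
    [(a + b)^2 <= 2 a^2 + 2 b^2] splits [|G|^2] into the contributions of [g1]
    and [g2], and the factor [1 / (4 pi^2)] coming from [1 / (2 pi i)] cancels
    the constants exactly: on every horizontal line the [L^2] norm of [G] is at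
    most that of [g] ([L2norm_cauchy_integral]), which is stronger than the
    bound with the factor 4.  The two half planes differ by the sign of the
    Poisson part, represented below by a real [e] with [e^2 = 1]. *)

(** * Integrals over the line of functions with an explicit primitive *)

Section poisson_kernels.
Variable R : realType.
Notation mu := (@lebesgue_measure R).
Implicit Types (f F : R -> R) (t s x y u v l : R).

(** Both limits are taken at [+oo], the second one along [F (- x)], because the
    primitives used below are mapped to primitives of the same family by
    [x |-> - x]: a single limit computation then serves both ends. *)
Lemma ge0_FTC2_line f F l l' :
  (forall x, 0 <= f x) -> continuous f ->
  (forall x, is_derive x 1 F (f x)) ->
  F x @[x --> +oo] --> l -> F (- x) @[x --> +oo] --> l' ->
  (\int[mu]_x (f x)%:E = (l - l')%:E)%E.
Proof.
move=> f0 cf dF Fl Fl'.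
have mf : measurable_fun [set: R] (EFin \o f).
  by apply/measurable_EFinP; exact: continuous_measurable_fun.
have cF : continuous F.
  move=> x; apply: differentiable_continuous; apply/derivable1_diffP.
  exact: (@ex_derive _ _ _ _ _ _ _ (dF x)).
have dFN x : is_derive x 1 (fun x => - F (- x)) (f (- x)).
  have -> : (fun x => - F (- x)) = - (F \o -%R) by [].
  rewrite -[f (- x)]opprK; apply: is_deriveN.
  rewrite -[- f _]mulrN1; apply: is_derive1_comp.
have half (h H : R -> R) m : (forall x, 0 <= h x) -> continuous h ->
    (forall x, is_derive x 1 H (h x)) -> continuous H ->
    H x @[x --> +oo] --> m ->
    (\int[mu]_(x in `[0%R, +oo[) (h x)%:E = (m - H 0)%:E)%E.
  move=> h0 ch dH cH Hm.
  rewrite (ge0_continuous_FTC2y (F := H) (l := m))//.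
  - exact: continuous_subspaceT.
  - by apply: cvg_at_right_filter; exact: cH.
  - by move=> x _; rewrite derive1E; apply: derive_val.
(* The half line on the left is reflected onto the one on the right, where
   [fun x => - F (- x)] is a primitive of [f (- x)]. *)
rewrite -(set_itvNyy) (@itv_bndbnd_setU _ _ -oo%O (BRight 0) +oo%O)//.
rewrite ge0_integral_setU//=; last 3 first.
  - exact: measurable_funS mf.
  - by move=> x _; rewrite lee_fin.
  - by apply/disj_setPS => x [] /=; rewrite !in_itv/= andbT => x0; rewrite ltNge x0.
have := @ge0_integration_by_substitutionNy R f 0.
rewrite oppr0 => ->//; last exact: continuous_subspaceT.
rewrite integral_itv_obnd_cbnd; last exact: measurable_funS mf.
rewrite (half f F l)// (half (f \o -%R) (fun x => - F (- x)) (- l'))//.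
- by rewrite -EFinD oppr0; congr EFin; ring.
- by move=> x /=.
- by move=> x; apply: (@continuous_comp _ _ _ -%R f); [exact: opp_continuous|exact: cf].
- move=> x; apply: cvgN.
  by apply: (@continuous_comp _ _ _ -%R F); [exact: opp_continuous|exact: cF].
- exact: cvgN.
Qed.

Lemma is_derive_shift t x : is_derive x 1 (fun x : R => x - t) 1.
Proof.
by rewrite -[1 in X in is_derive _ _ _ X](subr0 1); apply: is_deriveB.
Qed.

Lemma cvgy_shift t : (x - t : R) @[x --> +oo] --> +oo.
Proof. exact: cvg_addrr. Qed.

Lemma sqD_gt0 y u : 0 < y -> 0 < u ^+ 2 + y ^+ 2.
Proof. by move=> y0; rewrite ltr_wpDl ?sqr_ge0// exprn_gt0. Qed.

Definition atan_shift y t x := atan ((x - t) / y).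

Lemma is_derive_atan_shift y t x : 0 < y ->
  is_derive x 1 (atan_shift y t) (y / ((x - t) ^+ 2 + y ^+ 2)).
Proof.
move=> y0; have yN0 := lt0r_neq0 y0; have A0 := lt0r_neq0 (sqD_gt0 (x - t) y0).
have -> : y / ((x - t) ^+ 2 + y ^+ 2) = (1 + ((x - t) / y) ^+ 2)^-1 * y^-1.
  by field; rewrite yN0 addrC.
apply: (@is_derive1_comp _ atan (fun x => (x - t) / y)).
have -> : (fun x => (x - t) / y) = (y^-1 *: (fun x : R => x - t)).
  by apply/funext => z /=; rewrite mulrC.
have dx := is_derive_shift t x.
by apply: is_derive_eq; rewrite /GRing.scale/= mulr1.
Qed.

Lemma cvgy_atan_shift y t : 0 < y -> atan_shift y t x @[x --> +oo] --> pi / 2.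
Proof.
move=> y0; apply: (@cvg_comp _ _ _ (fun x : R => (x - t) / y) (@atan R));
  last exact: cvgy_atan.
apply/(cvgryPge (fun x : R => (x - t) / y)) => M; near=> x.
rewrite ler_pdivlMr// lerBrDr; near: x; exact/nbhs_pinfty_ge/num_real.
Unshelve. all: by end_near. Qed.

Lemma atan_shiftN y t x : atan_shift y t (- x) = - atan_shift y (- t) x.
Proof. by rewrite /atan_shift -atanN -mulNr; congr (atan (_ / _)); ring. Qed.

Definition ln_shift y t x := ln ((x - t) ^+ 2 + y ^+ 2).

Lemma is_derive_ln_shift y t x : 0 < y ->
  is_derive x 1 (ln_shift y t) (2 * (x - t) / ((x - t) ^+ 2 + y ^+ 2)).
Proof.
move=> y0; have A0 := sqD_gt0 (x - t) y0.
rewrite [2 * _ / _]mulrC.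
apply: (@is_derive1_comp _ (@ln R) (fun x => (x - t) ^+ 2 + y ^+ 2)).
  exact: is_derive1_ln.
have dx := is_derive_shift t x.
have -> : (fun x => (x - t) ^+ 2 + y ^+ 2) =
    (fun x : R => x - t) ^+ 2 + cst (y ^+ 2) by apply/funext.
by apply: is_derive_eq; rewrite addr0 /GRing.scale/= expr1 mulr1 mulr_natl.
Qed.

(** Each logarithm diverges, but the quotient of their arguments is
    [1 + O(1 / x)]. *)
Lemma cvgy_ln_shiftB y t s : 0 < y ->
  ln_shift y t x - ln_shift y s x @[x --> +oo] --> (0 : R).
Proof.
move=> y0; pose d := s - t.
have -> : (fun x => ln_shift y t x - ln_shift y s x) =
    @ln R \o (fun x => 1 + d * (2 * (x - s) + d) / ((x - s) ^+ 2 + y ^+ 2)).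
  apply/funext => x /=; have A0 := sqD_gt0 (x - t) y0.
  have B0 := sqD_gt0 (x - s) y0.
  rewrite -ln_div ?posrE//; congr ln.
  by rewrite /d; field; exact: lt0r_neq0.
suff : 1 + d * (2 * (x - s) + d) / ((x - s) ^+ 2 + y ^+ 2) @[x --> +oo] --> (1 : R).
  by move=> /(cvg_comp _ (@ln R)); apply; rewrite -(@ln1 R); exact: continuous_ln.
suff : d * (2 * (x - s) + d) / ((x - s) ^+ 2 + y ^+ 2) @[x --> +oo] --> (0 : R).
  by move=> /(cvgD (cvg_cst (1 : R))); rewrite addr0.
have xV : (x - s)^-1 @[x --> +oo] --> (0 : R).
  apply/(gtr0_cvgV0 (f := fun x => x - s)); last exact: cvgy_shift.
  by near=> x; rewrite subr_gt0; near: x; exact/nbhs_pinfty_gt/num_real.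
have xC C : C * (x - s)^-1 @[x --> +oo] --> (0 : R).
  by rewrite -(mulr0 C); apply: cvgM xV; exact: cvg_cst.
apply: (@squeeze_cvgr _ _ _ _ (fun x => - (`|d| * (2 + `|d|)) * (x - s)^-1)
                         (fun x => (`|d| * (2 + `|d|)) * (x - s)^-1)) => //.
near=> x.
have v1 : 1 <= x - s.
  by rewrite lerBrDr; near: x; exact/nbhs_pinfty_ge/num_real.
rewrite mulNr -ler_norml; have B0 := sqD_gt0 (x - s) y0.
rewrite normrM normfV (gtr0_norm B0) normrM -mulrA -[leRHS]mulrA.
have v0 : 0 < x - s by rewrite (lt_le_trans _ v1).
apply: ler_wpM2l => //.
rewrite ler_pdivrMr// [leRHS]mulrAC ler_pdivlMr//.
have dv : `|2 * (x - s) + d| <= 2 * (x - s) + `|d|.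
  by rewrite (le_trans (ler_normD _ _))// normrM (gtr0_norm v0) ger0_norm.
rewrite (le_trans (ler_wpM2r (ltW v0) dv))//.
have : 0 <= `|d| by [].
set e := `|d|; set v := x - s in v0 v1 B0 *.
move=> e0.
have ev : 0 <= e * v * (v - 1) by rewrite mulr_ge0 ?subr_ge0// mulr_ge0// ltW.
have : 0 <= (2 + e) * y ^+ 2 by rewrite mulr_ge0// ?sqr_ge0// addr_ge0.
nra.
Unshelve. all: by end_near. Qed.

Lemma ln_shiftN y t x : ln_shift y t (- x) = ln_shift y (- t) x.
Proof. by rewrite /ln_shift; congr (ln _); ring. Qed.

Lemma continuous_invD y t : 0 < y ->
  continuous (fun x => ((x - t) ^+ 2 + y ^+ 2)^-1).
Proof.
move=> y0 x; apply: cvgV; first exact/lt0r_neq0/sqD_gt0.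
apply: cvgD; last exact: cvg_cst.
have cx : x0 - t @[x0 --> x] --> x - t by apply: cvgB; [exact: cvg_id|exact: cvg_cst].
under eq_fun do rewrite expr2.
by rewrite expr2; apply: cvgM.
Qed.

(** * The Poisson kernel and its conjugate *)

(** These are [pi] times the usual normalised kernels: leaving out [1 / pi]
    makes [poisson y u] and [conj_poisson y u] the imaginary and the real part
    of [(u - i y)^-1]. *)
Definition poisson y u := y / (u ^+ 2 + y ^+ 2).
Definition conj_poisson y u := u / (u ^+ 2 + y ^+ 2).

Lemma continuous_poisson y : 0 < y -> continuous (poisson y).
Proof.
move=> y0 x.
have -> : poisson y = fun u => y * ((u - 0) ^+ 2 + y ^+ 2)^-1.
  by apply/funext => u; rewrite subr0.
by apply: cvgM; [exact: cvg_cst|exact: continuous_invD].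
Qed.

Lemma continuous_conj_poisson y : 0 < y -> continuous (conj_poisson y).
Proof.
move=> y0 x.
have -> : conj_poisson y = fun u => u * ((u - 0) ^+ 2 + y ^+ 2)^-1.
  by apply/funext => u; rewrite subr0.
by apply: cvgM; [exact: cvg_id|exact: continuous_invD].
Qed.

Lemma measurable_poisson y : 0 < y -> measurable_fun [set: R] (poisson y).
Proof.
by move=> y0; apply: continuous_measurable_fun; exact: continuous_poisson.
Qed.

Lemma measurable_conj_poisson y : 0 < y -> measurable_fun [set: R] (conj_poisson y).
Proof.
by move=> y0; apply: continuous_measurable_fun; exact: continuous_conj_poisson.
Qed.

Lemma poissonN y u : poisson y (- u) = poisson y u :> R.
Proof. by rewrite /poisson sqrrN. Qed.

Lemma poisson_ge0 y u : 0 < y -> 0 <= poisson y u :> R.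
Proof. by move=> y0; rewrite divr_ge0 ?ltW// sqD_gt0. Qed.

Lemma poisson_sqr_le y u : 0 < y -> poisson y u ^+ 2 <= (u ^+ 2 + y ^+ 2)^-1.
Proof.
move=> y0; have A0 := sqD_gt0 u y0.
rewrite /poisson exprMn exprVn ler_pdivrMr ?exprn_gt0// [in leRHS]expr2.
rewrite mulrA mulVf ?lt0r_neq0// mul1r.
by rewrite lerDr sqr_ge0.
Qed.

Lemma conj_poisson_sqr_le y u : 0 < y -> conj_poisson y u ^+ 2 <= (u ^+ 2 + y ^+ 2)^-1.
Proof.
move=> y0; have A0 := sqD_gt0 u y0.
rewrite /conj_poisson exprMn exprVn ler_pdivrMr ?exprn_gt0// [in leRHS]expr2.
rewrite mulrA mulVf ?lt0r_neq0// mul1r.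
by rewrite lerDl sqr_ge0.
Qed.

Lemma measurable_shift (k : R -> R) x : measurable_fun [set: R] k ->
  measurable_fun [set: R] (fun t => k (t - x)).
Proof.
move=> mk; apply: (measurableT_comp mk); apply: measurable_funB => //.
Qed.

Lemma integral_poisson y t : 0 < y ->
  (\int[mu]_x (poisson y (x - t))%:E = pi%:E)%E.
Proof.
move=> y0.
have -> : pi = pi / 2 - - (pi / 2) :> R by field.
apply: (@ge0_FTC2_line _ (atan_shift y t)).
- by move=> x; exact: poisson_ge0.
- by move=> x; apply: cvgM; [exact: cvg_cst|exact: continuous_invD].
- by move=> x; exact: is_derive_atan_shift.
- exact: cvgy_atan_shift.
- under eq_fun do rewrite atan_shiftN.
  by apply: cvgN; exact: cvgy_atan_shift.
Qed.

Lemma integrable_poisson y t : 0 < y ->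
  mu.-integrable [set: R] (fun x => (poisson y (x - t))%:E).
Proof.
move=> y0; apply/integrableP; split.
  by apply/measurable_EFinP; exact: measurable_shift (measurable_poisson y0).
under eq_integral do rewrite gee0_abs ?lee_fin ?poisson_ge0//.
by rewrite integral_poisson// ltry.
Qed.

(** The factor [(s - t)^2] makes the formula hold for [s = t] too and removes
    the singularity of the partial fraction decomposition at [s = t].  With
    [d = s - t], [A = (x - t)^2 + y^2], [B = (x - s)^2 + y^2], that decomposition
    reads
    [(d^2 + 4 y^2) d^2 / (A B) =
       d^2 (1 / A + 1 / B) + d (2 (x - t) / A - 2 (x - s) / B)],
    whose primitive is a combination of two arctangents and two logarithms. *)
Lemma integral_poisson_prod y t s : 0 < y ->
  (\int[mu]_x ((s - t) ^+ 2 *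
      (((x - t) ^+ 2 + y ^+ 2)^-1 * ((x - s) ^+ 2 + y ^+ 2)^-1))%:E =
   ((s - t) ^+ 2 / ((s - t) ^+ 2 + (2 * y) ^+ 2) * (2 * pi / y))%:E)%E.
Proof.
move=> y0; set d := s - t; set D := d ^+ 2 + (2 * y) ^+ 2.
have yN0 := lt0r_neq0 y0.
have D0 : 0 < D by apply: sqD_gt0; rewrite mulr_gt0.
pose F x := (d ^+ 2 / D / y) * (atan_shift y t x + atan_shift y s x) +
            (d / D) * (ln_shift y t x - ln_shift y s x).
have cvgF t' s' (a b : R) : a * (atan_shift y t' x + atan_shift y s' x) +
    b * (ln_shift y t' x - ln_shift y s' x) @[x --> +oo] --> a * pi.
  rewrite [X in _ * X]splitr -[X in _ --> X]addr0; apply: cvgD.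
    by apply: cvgM; [exact: cvg_cst|apply: cvgD; exact: cvgy_atan_shift].
  by rewrite -(mulr0 b); apply: cvgM; [exact: cvg_cst|exact: cvgy_ln_shiftB].
have -> : d ^+ 2 / D * (2 * pi / y) =
    (d ^+ 2 / D / y) * pi - - (d ^+ 2 / D / y) * pi :> R.
  by field; rewrite yN0 lt0r_neq0.
apply: (@ge0_FTC2_line (fun x => d ^+ 2 *
  (((x - t) ^+ 2 + y ^+ 2)^-1 * ((x - s) ^+ 2 + y ^+ 2)^-1)) F
  (d ^+ 2 / D / y * pi) (- (d ^+ 2 / D / y) * pi)).
- by move=> x; rewrite mulr_ge0 ?sqr_ge0// mulr_ge0// invr_ge0 ltW// sqD_gt0.
- move=> x; apply: cvgM; first exact: cvg_cst.
  by apply: cvgM; exact: continuous_invD.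
- move=> x; have dAt := is_derive_atan_shift t x y0.
  have dAs := is_derive_atan_shift s x y0.
  have dLt := is_derive_ln_shift t x y0; have dLs := is_derive_ln_shift s x y0.
  have dF := is_deriveD (is_deriveZ (d ^+ 2 / D / y) (is_deriveD dAt dAs))
                        (is_deriveZ (d / D) (is_deriveB dLt dLs)).
  apply: (is_derive_eq dF); rewrite /GRing.scale/= /D /d; field.
  by rewrite -/d -/D yN0 !lt0r_neq0// sqD_gt0.
- exact: cvgF.
- under eq_fun do rewrite /F !atan_shiftN !ln_shiftN -opprD mulrN -mulNr.
  exact: cvgF.
Qed.

(** The real part of [K (t - x) * conj (K (s - x))], for [K u = (u - i y)^-1]. *)
Definition kernel_corr y t s x := ((t - x) * (s - x) + y ^+ 2) *
  (((x - t) ^+ 2 + y ^+ 2)^-1 * ((x - s) ^+ 2 + y ^+ 2)^-1).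

(** With [u = t - x] and [v = s - x], this is [2 |u v| <= u^2 + v^2]. *)
Lemma kernel_corr_bound y t s x : 0 < y -> `|kernel_corr y t s x| <=
  (2 * y)^-1 * (poisson y (x - t) + poisson y (x - s)).
Proof.
move=> y0; have A0 := sqD_gt0 (x - t) y0; have B0 := sqD_gt0 (x - s) y0.
have -> : (2 * y)^-1 * (poisson y (x - t) + poisson y (x - s)) =
   ((x - t) ^+ 2 + y ^+ 2 + ((x - s) ^+ 2 + y ^+ 2)) / 2 *
   (((x - t) ^+ 2 + y ^+ 2)^-1 * ((x - s) ^+ 2 + y ^+ 2)^-1).
  by rewrite /poisson; field; rewrite !lt0r_neq0.
rewrite /kernel_corr normrM [X in _ * X]ger0_norm; last first.
  by rewrite mulr_ge0// invr_ge0 ltW.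
apply: ler_wpM2r; first by rewrite mulr_ge0// invr_ge0 ltW.
have := sqr_ge0 (t - s); have := sqr_ge0 ((t - x) + (s - x)).
by have := sqr_ge0 y; rewrite ler_norml; move=> *; apply/andP; split; lra.
Qed.

(** The correlation of two Cauchy kernels of height [y] is a Poisson kernel of
    height [2 y].  Since [2 u v = u^2 + v^2 - (u - v)^2], the correlation is a
    combination of nonnegative integrable functions of [x] whose integrals are
    known.  Partial fractions of the correlation itself would instead produce
    conjugate kernels, whose integrals diverge. *)
Lemma integral_kernel_corr y t s : 0 < y ->
  (\int[mu]_x (kernel_corr y t s x)%:E =
   (2 * pi * poisson (2 * y) (s - t))%:E)%E.
Proof.
move=> y0; have yN0 := lt0r_neq0 y0.
pose h x := (s - t) ^+ 2 *
      (((x - t) ^+ 2 + y ^+ 2)^-1 * ((x - s) ^+ 2 + y ^+ 2)^-1).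
have h0 x : 0 <= h x.
  by rewrite mulr_ge0 ?sqr_ge0// mulr_ge0// invr_ge0 ltW// sqD_gt0.
have ih : mu.-integrable [set: R] (EFin \o h).
  apply/integrableP; split.
    apply/measurable_EFinP; apply: continuous_measurable_fun => x.
    apply: cvgM; first exact: cvg_cst.
    by apply: cvgM; exact: continuous_invD.
  under eq_integral => x _ do rewrite /= ger0_norm//.
  by rewrite integral_poisson_prod// ltry.
have ip := @integrable_poisson y.
have ipts := integrableD measurableT (ip t y0) (ip s y0).
under eq_integral => x _.
  have -> : (kernel_corr y t s x)%:E =
    (((2 * y)^-1)%R%:E * ((poisson y (x - t))%:E + (poisson y (x - s))%:E)
       - (2^-1)%R%:E * (h x)%:E)%E.
    congr EFin; rewrite /kernel_corr /h /poisson.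
    field; rewrite yN0 !lt0r_neq0 ?sqD_gt0//.
  over.
rewrite integralB//; [|exact: integrableZl|exact: integrableZl].
rewrite integralZl// integralZl//= integralD//; [|exact: ip|exact: ip].
rewrite !integral_poisson// integral_poisson_prod//.
congr EFin.
by rewrite /poisson; field; rewrite yN0 lt0r_neq0// sqD_gt0// mulr_gt0.
Qed.

Lemma kernel_corrE y t s x : 0 < y ->
  kernel_corr y t s x = conj_poisson y (t - x) * conj_poisson y (s - x) +
                        poisson y (t - x) * poisson y (s - x).
Proof.
move=> y0; rewrite /kernel_corr /conj_poisson /poisson.
rewrite -(sqrrN (x - t)) -(sqrrN (x - s)) !opprB.
by field; rewrite !lt0r_neq0// sqD_gt0.
Qed.

End poisson_kernels.

(** * Lebesgue measure on the plane *)

Section plane_measure.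
Variable R : realType.
Notation mu := (@lebesgue_measure R).

(** The sigma-finite structure is attached to this name so that the plane can be
    a factor of a further product; on the bare product, inference selects the
    structure of a product of sub-probabilities. *)
Definition plane_measure : set (measurableTypeR R * measurableTypeR R) -> \bar R :=
  (mu \x mu)%E.

HB.instance Definition _ := Measure.on plane_measure.

Let plane_measure_sigma_finite : sigma_finite setT plane_measure.
Proof.
have /sigma_finiteP[F [TF ndF Foo]] := sigma_finiteT mu.
exists (fun n => F n `*` F n) => [|n].
  rewrite -setXTT TF predeqE => -[x y]; split.
    move=> [/= [n _ Fnx] [k _ Fky]]; exists (maxn n k) => //; split.
    - by move: x Fnx; exact/subsetPset/ndF/leq_maxl.
    - by move: y Fky; exact/subsetPset/ndF/leq_maxr.
  by move=> [n _ []/= ? ?]; split; exists n.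
have [mFn Fny] := Foo n; split; first exact: measurableX.
by rewrite /plane_measure product_measure1E// lte_mul_pinfty// ge0_fin_numE.
Qed.

HB.instance Definition _ := Measure_isSigmaFinite.Build _ _ _ plane_measure
  plane_measure_sigma_finite.

End plane_measure.

Section tensor.
Variable R : realType.
Notation mu := (@lebesgue_measure R).
Notation P := (@plane_measure R).
Implicit Types (g : R -> R) (t s x y : R).

Lemma integral_tensor (f h : R -> R) :
  mu.-integrable setT (EFin \o f) -> mu.-integrable setT (EFin \o h) ->
  P.-integrable setT (fun z => (f z.1 * h z.2)%:E) /\
  (\int[P]_z (f z.1 * h z.2)%:E = (\int[mu]_x f x * \int[mu]_x h x)%R%:E)%E.
Proof.
move=> intf inth; have mf := measurable_int _ intf; have mh := measurable_int _ inth.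
have mabs (k : R -> R) : measurable_fun [set: measurableTypeR R] (EFin \o k) ->
    measurable_fun [set: measurableTypeR R] (fun x => (`|k x|)%:E).
  move=> /measurable_EFinP mk; apply/measurable_EFinP.
  exact: measurableT_comp mk.
have mfh : measurable_fun [set: measurableTypeR R * measurableTypeR R]
    (fun z => (f z.1 * h z.2)%:E).
  apply/measurable_EFinP; apply: measurable_funM.
    by apply: (measurableT_comp (f := f)) => //; exact/measurable_EFinP.
  by apply: (measurableT_comp (f := h)) => //; exact/measurable_EFinP.
have intfh : (mu \x mu)%E.-integrable setT (fun z => (f z.1 * h z.2)%:E).
  apply/integrable12ltyP => //.
  under eq_integral => x _.
    under eq_integral => y _ do rewrite /= normrM EFinM.
    rewrite ge0_integralZl//; last exact: (mabs _ mh).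
    over.
  rewrite ge0_integralZr//; [|exact: (mabs _ mf)|exact: integral_ge0].
  move/integrableP : intf => [_ intf]; move/integrableP : inth => [_ inth].
  apply: lte_mul_pinfty => //; first exact: integral_ge0.
  by rewrite ge0_fin_numE//; exact: integral_ge0.
split => //.
transitivity (\int[mu \x mu]_z (f z.1 * h z.2)%:E)%E => //.
rewrite -integral12_prod_meas1// /fubini_F.
under eq_integral => x _.
  under eq_integral => y _ do rewrite /= EFinM.
  rewrite integralZl//; over.
rewrite /= EFinM /Rintegral !fineK; [|exact: integrable_fin_num..].
have Ih : (\int[mu]_x (h x)%:E)%E \is a fin_num by exact: integrable_fin_num.
by rewrite -(fineK Ih) integralZr.
Qed.

End tensor.

(** * Integrals against the two kernels *)

Section energy.
Variable R : realType.
Notation mu := (@lebesgue_measure R).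
Notation P := (@plane_measure R).
Implicit Types (g : R -> R) (t s x y : R).

(** A square integrable function times a square integrable kernel: the bound
    on [k] says that [k^2] is dominated by [y^-1] times the Poisson kernel. *)
Lemma integrable_mul_kernel g (k : R -> R) y x : 0 < y ->
  measurable_fun [set: R] g -> mu.-integrable setT (fun t => (g t ^+ 2)%:E) ->
  measurable_fun [set: R] k -> (forall u, k u ^+ 2 <= (u ^+ 2 + y ^+ 2)^-1) ->
  mu.-integrable setT (fun t => (g t * k (t - x))%:E).
Proof.
move=> y0 mg ig2 mk kle.
apply: (@le_integrable _ (measurableTypeR R) _ _ _ measurableT _
  (fun t => ((g t ^+ 2)%:E + (y^-1)%R%:E * (poisson y (t - x))%:E)%E)) => //.
- apply/measurable_EFinP; apply: measurable_funM => //; exact: measurable_shift.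
- move=> t _; rewrite -EFinM -EFinD /= lee_fin.
  have -> : y^-1 * poisson y (t - x) = ((t - x) ^+ 2 + y ^+ 2)^-1.
    by rewrite /poisson mulrA mulVf ?mul1r// lt0r_neq0.
  have A0 : 0 <= ((t - x) ^+ 2 + y ^+ 2)^-1 by rewrite invr_ge0 ltW// sqD_gt0.
  rewrite [leRHS]ger0_norm ?addr_ge0 ?sqr_ge0//.
  rewrite (le_trans _ (lerD (lexx _) (kle (t - x))))// normrM.
  rewrite -(real_normK (num_real (g t))) -(real_normK (num_real (k (t - x)))).
  have := sqr_ge0 (`|g t| - `|k (t - x)|); nra.
- by apply: integrableD => //; apply: integrableZl => //; exact: integrable_poisson.
Qed.

Lemma integrable_mul_poisson g y x : 0 < y -> measurable_fun [set: R] g ->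
  mu.-integrable setT (fun t => (g t ^+ 2)%:E) ->
  mu.-integrable setT (fun t => (g t * poisson y (t - x))%:E).
Proof.
move=> y0 mg ig2; apply: (integrable_mul_kernel _ y0) => //.
  exact: measurable_poisson.
by move=> u; exact: poisson_sqr_le.
Qed.

Lemma integrable_mul_conj_poisson g y x : 0 < y -> measurable_fun [set: R] g ->
  mu.-integrable setT (fun t => (g t ^+ 2)%:E) ->
  mu.-integrable setT (fun t => (g t * conj_poisson y (t - x))%:E).
Proof.
move=> y0 mg ig2; apply: (integrable_mul_kernel _ y0) => //.
  exact: measurable_conj_poisson.
by move=> u; exact: conj_poisson_sqr_le.
Qed.

Definition conj_poisson_int y g x := \int[mu]_t (g t * conj_poisson y (t - x)).
Definition poisson_int y g x := \int[mu]_t (g t * poisson y (t - x)).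

(** The integrand over [(x, (t, s))] obtained by expanding the squares in
    [int (U^2 + V^2)].  Integrating out [(t, s)] gives back [U^2 + V^2] at [x];
    integrating out [x] gives the quadratic form of a Poisson kernel. *)
Definition energy y g
    (p : measurableTypeR R * (measurableTypeR R * measurableTypeR R)) :=
  g p.2.1 * g p.2.2 * kernel_corr y p.2.1 p.2.2 p.1.

Lemma energyE y g x z : 0 < y -> energy y g (x, z) =
  (g z.1 * conj_poisson y (z.1 - x)) * (g z.2 * conj_poisson y (z.2 - x)) +
  (g z.1 * poisson y (z.1 - x)) * (g z.2 * poisson y (z.2 - x)).
Proof. by move=> y0; rewrite /energy kernel_corrE//=; ring. Qed.

Lemma measurable_energy y g : 0 < y -> measurable_fun [set: R] g ->
  measurable_fun setT (energy y g).
Proof.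
move=> y0 mg.
have -> : energy y g = fun p =>
    (g p.2.1 * conj_poisson y (p.2.1 - p.1)) *
    (g p.2.2 * conj_poisson y (p.2.2 - p.1)) +
    (g p.2.1 * poisson y (p.2.1 - p.1)) * (g p.2.2 * poisson y (p.2.2 - p.1)).
  by apply/funext => -[x z]; exact: energyE.
pose T : measurableType _ :=
  (measurableTypeR R * (measurableTypeR R * measurableTypeR R))%type.
have m1 : measurable_fun setT (fun p : T => p.2.1).
  exact: (measurableT_comp measurable_fst).
have m2 : measurable_fun setT (fun p : T => p.2.2).
  exact: (measurableT_comp measurable_snd).
have mm (c : T -> measurableTypeR R) (k : R -> R) :
    measurable_fun setT c -> measurable_fun [set: R] k ->
    measurable_fun setT (fun p => g (c p) * k (c p - p.1)).
  move=> mc mk; apply: measurable_funM; first exact: measurableT_comp mc.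
  apply: (measurableT_comp mk); apply: measurable_funB => //.
apply: measurable_funD; apply: measurable_funM; apply: mm => //;
  first [exact: measurable_conj_poisson|exact: measurable_poisson].
Qed.

Section integrable_square_integrable.
Variables (y : R) (g : R -> R).
Hypothesis y0 : 0 < y.
Hypothesis ig : mu.-integrable setT (EFin \o g).
Hypothesis ig2 : mu.-integrable setT (fun t => (g t ^+ 2)%:E).

Let mg : measurable_fun [set: R] g.
Proof. by apply/measurable_EFinP; exact: measurable_int ig. Qed.

Lemma integral_energy_plane x :
  (\int[P]_z (energy y g (x, z))%:E =
   (conj_poisson_int y g x ^+ 2 + poisson_int y g x ^+ 2)%:E)%E.
Proof.
have iq := integrable_mul_conj_poisson x y0 mg ig2.
have ip := integrable_mul_poisson x y0 mg ig2.
have [iqq eqq] := integral_tensor iq iq; have [ipp epp] := integral_tensor ip ip.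
under eq_integral do rewrite energyE// EFinD.
by rewrite integralD// [X in (X + _)%E]eqq [X in (_ + X)%E]epp.
Qed.

Lemma integral_energy_line (z : R * R) : (\int[mu]_x (energy y g (x, z))%:E =
  (g z.1 * g z.2 * (2 * pi * poisson (2 * y) (z.2 - z.1)))%:E)%E.
Proof.
under eq_integral do rewrite /energy EFinM /=.
rewrite integralZl//=; last first.
  apply: (@le_integrable _ (measurableTypeR R) _ _ _ measurableT _
    (fun x => ((2 * y)^-1%R%:E *
     ((poisson y (x - z.1))%:E + (poisson y (x - z.2))%:E))%E)) => //.
  - apply/measurable_EFinP.
    have -> : kernel_corr y z.1 z.2 = fun x =>
        conj_poisson y (z.1 - x) * conj_poisson y (z.2 - x) +
        poisson y (z.1 - x) * poisson y (z.2 - x).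
      by apply/funext => x; exact: kernel_corrE.
    have mm (k : R -> R) s : measurable_fun [set: R] k ->
        measurable_fun [set: R] (fun x => k (s - x)).
      by move=> mk; apply: (measurableT_comp mk); apply: measurable_funB.
    by apply: measurable_funD; apply: measurable_funM; apply: mm;
      first [exact: measurable_conj_poisson|exact: measurable_poisson].
  - move=> x _; rewrite -EFinD -EFinM /= lee_fin.
    by rewrite (le_trans (kernel_corr_bound _ _ _ y0))// ler_norm.
  - by apply: integrableZl => //; apply: integrableD => //; exact: integrable_poisson.
by rewrite integral_kernel_corr.
Qed.

(** Absolute integrability comes from integrating over [x] first: by
    [kernel_corr_bound], the inner integral is at most
    [|g(t)| |g(s)| pi / y], which is integrable in [(t, s)] because [g] is
    integrable. *)
Lemma integrable_energy : (mu \x P)%E.-integrable setT (EFin \o energy y g).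
Proof.
apply/integrable21ltyP; first by apply/measurable_EFinP; exact: measurable_energy.
have iag : mu.-integrable setT (fun t => (`|g t|)%:E) by exact: integrable_abse ig.
have [igg egg] := integral_tensor iag iag.
apply: (@le_lt_trans _ _
  (\int[P]_z ((pi / y)%:E * (`|g z.1| * `|g z.2|)%:E)%E)%E); last first.
  by rewrite integralZl// egg -EFinM ltry.
apply: ge0_le_integral => //.
- by move=> z _; exact: integral_ge0.
- apply: (measurable_fun_fubini_tonelli_G (fun p => `|(energy y g p)%:E|)%E) => //.
  by apply: measurableT_comp => //; apply/measurable_EFinP; exact: measurable_energy.
- exact: measurable_int (integrableZl _ _ igg).
- move=> z _; apply: (@le_trans _ _ (\int[mu]_x ((`|g z.1| * `|g z.2| / (2 * y))%:E *
     ((poisson y (x - z.1))%:E + (poisson y (x - z.2))%:E))%E)%E).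
    apply: ge0_le_integral => //.
    + apply: measurableT_comp => //.
      apply: (measurableT_comp (f := EFin \o energy y g)) => //.
      by apply/measurable_EFinP; exact: measurable_energy.
    + apply: (measurable_int mu); apply: integrableZl => //.
      by apply: integrableD => //; exact: integrable_poisson.
    + move=> x _; rewrite -EFinD -EFinM /= lee_fin /energy /=.
      rewrite normrM (normrM (g z.1)) -[leRHS]mulrA.
      by apply: ler_wpM2l => //; exact: kernel_corr_bound.
  rewrite integralZl//; last by apply: integrableD => //; exact: integrable_poisson.
  rewrite integralD//; [|exact: integrable_poisson..].
  rewrite !integral_poisson// -EFinD -!EFinM lee_fin le_eqVlt; apply/orP; left; apply/eqP.
  by field; rewrite lt0r_neq0.
Qed.

End integrable_square_integrable.

End energy.

(** * The bound for integrable, square integrable functions *)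

Section Schur.
Variable R : realType.
Notation mu := (@lebesgue_measure R).
Notation P := (@plane_measure R).
Implicit Types (g : R -> R) (t s x y : R).

Lemma measurable_poissonB y : 0 < y -> measurable_fun setT
  (fun z : measurableTypeR R * measurableTypeR R => poisson y (z.2 - z.1)).
Proof.
by move=> y0; apply: (measurableT_comp (measurable_poisson y0)); apply: measurable_funB.
Qed.

Lemma integral_sqr_poisson1 g y : 0 < y -> measurable_fun [set: R] g ->
  (\int[P]_z (g z.1 ^+ 2 * poisson y (z.2 - z.1))%:E =
   pi%:E * \int[mu]_t (g t ^+ 2)%:E)%E.
Proof.
move=> y0 mg; have mg2 : measurable_fun [set: R] (fun t => g t ^+ 2).
  exact: measurable_funX.
transitivity (\int[mu \x mu]_z (g z.1 ^+ 2 * poisson y (z.2 - z.1))%:E)%E => //.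
rewrite fubini_tonelli1//; last 2 first.
- apply/measurable_EFinP; apply: measurable_funM; last exact: measurable_poissonB.
  exact: (measurableT_comp mg2).
- by move=> z; rewrite lee_fin mulr_ge0 ?sqr_ge0// poisson_ge0.
rewrite /fubini_F; under eq_integral => t _.
  under eq_integral do rewrite /= EFinM.
  rewrite ge0_integralZl_EFin ?sqr_ge0//; last 2 first.
  - by move=> s _; rewrite lee_fin poisson_ge0.
  - apply/measurable_EFinP; exact: measurable_shift (measurable_poisson y0).
  rewrite integral_poisson// muleC; over.
rewrite ge0_integralZl_EFin ?pi_ge0//.
- by move=> t _; rewrite lee_fin sqr_ge0.
- exact/measurable_EFinP.
Qed.

Lemma integral_sqr_poisson2 g y : 0 < y -> measurable_fun [set: R] g ->
  (\int[P]_z (g z.2 ^+ 2 * poisson y (z.2 - z.1))%:E =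
   pi%:E * \int[mu]_t (g t ^+ 2)%:E)%E.
Proof.
move=> y0 mg; have mg2 : measurable_fun [set: R] (fun t => g t ^+ 2).
  exact: measurable_funX.
transitivity (\int[mu \x mu]_z (g z.2 ^+ 2 * poisson y (z.2 - z.1))%:E)%E => //.
rewrite fubini_tonelli2//; last 2 first.
- apply/measurable_EFinP; apply: measurable_funM; last exact: measurable_poissonB.
  exact: (measurableT_comp mg2).
- by move=> z; rewrite lee_fin mulr_ge0 ?sqr_ge0// poisson_ge0.
rewrite /fubini_G; under eq_integral => t _.
  under eq_integral => s _ do rewrite /= EFinM -poissonN opprB.
  rewrite ge0_integralZl_EFin ?sqr_ge0//; last 2 first.
  - by move=> s _; rewrite lee_fin poisson_ge0.
  - apply/measurable_EFinP; exact: measurable_shift (measurable_poisson y0).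
  rewrite integral_poisson// muleC; over.
rewrite ge0_integralZl_EFin ?pi_ge0//.
- by move=> t _; rewrite lee_fin sqr_ge0.
- exact/measurable_EFinP.
Qed.

(** Schur's test for the symmetric kernel [2 pi * poisson (2 y) (s - t)], each
    of whose sections has integral [2 pi^2]. *)
Lemma poisson_pair_L2_bound_integrable g y : 0 < y -> mu.-integrable setT (EFin \o g) ->
  mu.-integrable setT (fun t => (g t ^+ 2)%:E) ->
  (\int[mu]_x (conj_poisson_int y g x ^+ 2 + poisson_int y g x ^+ 2)%:E <=
   (2 * pi ^+ 2)%:E * \int[mu]_t (g t ^+ 2)%:E)%E.
Proof.
move=> y0 ig ig2.
have mg : measurable_fun [set: R] g by apply/measurable_EFinP; exact: measurable_int ig.
have yy0 : 0 < 2 * y by rewrite mulr_gt0.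
have ienergy := integrable_energy y0 ig.
under eq_integral do rewrite -integral_energy_plane//.
rewrite [leLHS](integral12_prod_meas1 ienergy) -(integral21_prod_meas1 ienergy).
have GE : fubini_G mu (EFin \o energy y g) =
    (fun z => (g z.1 * g z.2 * (2 * pi * poisson (2 * y) (z.2 - z.1)))%:E).
  by apply/funext => z; rewrite /fubini_G/= integral_energy_line.
have mG := measurable_fubini_G ienergy; rewrite GE in mG *.
have msq1 : measurable_fun setT (fun z : measurableTypeR R * measurableTypeR R =>
    (g z.1 ^+ 2 * poisson (2 * y) (z.2 - z.1))%:E).
  apply/measurable_EFinP/measurable_funM; last exact: measurable_poissonB.
  by apply: measurable_funX; exact: (measurableT_comp mg).
have msq2 : measurable_fun setT (fun z : measurableTypeR R * measurableTypeR R =>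
    (g z.2 ^+ 2 * poisson (2 * y) (z.2 - z.1))%:E).
  apply/measurable_EFinP/measurable_funM; last exact: measurable_poissonB.
  by apply: measurable_funX; exact: (measurableT_comp mg).
have sq0 (c u : R) : (0 <= (c ^+ 2 * poisson (2 * y) u)%:E)%E.
  by rewrite lee_fin mulr_ge0 ?sqr_ge0// poisson_ge0.
apply: (@le_trans _ _ (\int[P]_z (pi%:E * ((g z.1 ^+ 2 * poisson (2 * y) (z.2 - z.1))%:E +
    (g z.2 ^+ 2 * poisson (2 * y) (z.2 - z.1))%:E))%E)%E).
  apply: (le_trans _ (le_trans (le_abse_integral P measurableT mG) _)).
    exact: lee_abs.
  apply: ge0_le_integral => //.
  - by apply: measurableT_comp => //; exact: mG.
  - by apply: emeasurable_funM => //; exact: emeasurable_funD.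
  move=> z _; rewrite /= -EFinD -EFinM lee_fin -mulrDl.
  rewrite normrM [X in _ * X]ger0_norm; last first.
    by rewrite mulr_ge0 ?poisson_ge0// mulr_ge0 ?pi_ge0.
  have -> : `|g z.1 * g z.2| * (2 * pi * poisson (2 * y) (z.2 - z.1)) =
    pi * ((`|g z.1 * g z.2| * 2) * poisson (2 * y) (z.2 - z.1)) by ring.
  apply: ler_wpM2l; first exact: pi_ge0.
  apply: ler_wpM2r; first exact: poisson_ge0.
  rewrite normrM -(real_normK (num_real (g z.1))) -(real_normK (num_real (g z.2))).
  have := sqr_ge0 (`|g z.1| - `|g z.2|); nra.
rewrite ge0_integralZl_EFin ?pi_ge0//; last 2 first.
- by move=> z _; rewrite adde_ge0.
- exact: emeasurable_funD.
rewrite ge0_integralD// integral_sqr_poisson1// integral_sqr_poisson2//.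
have I2 : (\int[mu]_t (g t ^+ 2)%:E)%E \is a fin_num by exact: integrable_fin_num.
rewrite -(fineK I2) -!EFinM lee_fin.
by rewrite le_eqVlt; apply/orP; left; apply/eqP; ring.
Qed.

End Schur.

(** * The bound for square integrable functions *)

Section square_integrable.
Variable R : realType.
Notation mu := (@lebesgue_measure R).
Implicit Types (g : R -> R) (t s x y : R).

Definition truncation g (n : nat) t := g t * \1_(`[- n%:R, n%:R]%classic) t.

Lemma truncation_cvg g t : \forall n \near \oo, truncation g n t = g t.
Proof.
near=> n; rewrite /truncation indicE mem_set ?mulr1//=.
rewrite in_itv/= -ler_norml; near: n; exact: nbhs_infty_ger.
Unshelve. all: by end_near. Qed.

Lemma truncation_le g n t : `|truncation g n t| <= `|g t|.
Proof.
rewrite /truncation indicE normrM; case: (_ \in _).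
  by rewrite normr1 mulr1.
by rewrite normr0 mulr0.
Qed.

Lemma measurable_truncation g n : measurable_fun [set: R] g ->
  measurable_fun [set: R] (truncation g n).
Proof. by move=> mg; apply: measurable_funM => //. Qed.

Lemma cvg_integral_truncation g (k : R -> R) : measurable_fun [set: R] g ->
  measurable_fun [set: R] k ->
  mu.-integrable setT (fun t => (g t * k t)%:E) ->
  \int[mu]_t (truncation g n t * k t) @[n --> \oo] --> \int[mu]_t (g t * k t).
Proof.
move=> mg mk igk; apply: fine_cvg.
rewrite fineK; last exact: integrable_fin_num.
apply: (@dominated_cvg _ (measurableTypeR R) _ _ _ measurableT _ _
  (fun t => `|(g t * k t)%:E|%E)).
- move=> n; apply/measurable_EFinP/measurable_funM => //.
  exact: measurable_truncation.
- move=> t _; apply: cvg_near_cst; have := truncation_cvg g t.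
  by apply: filterS => n ->.
- by [].
- exact: integrable_abse.
- move=> n t _; rewrite /= lee_fin [leRHS]normrM [leLHS]normrM.
  by rewrite ler_wpM2r// truncation_le.
Qed.

Lemma limn_einf_le (u : (\bar R)^nat) (C : \bar R) :
  (forall n, (u n <= C)%E) -> (limn_einf u <= C)%E.
Proof.
move=> uC; rewrite limn_einf_lim; apply: lime_le; first exact: is_cvg_einfs.
apply: nearW => n; apply: le_trans (uC n).
by apply: ereal_inf_lbound; exists n => //=.
Qed.

(** Truncations of [g] are integrable, and their two integrals converge at every
    [x] by dominated convergence, so Fatou's lemma passes the bound to the
    limit.  The same limit gives measurability in [x]. *)
Lemma poisson_pair_L2_bound g y : 0 < y -> measurable_fun [set: R] g ->
  mu.-integrable setT (fun t => (g t ^+ 2)%:E) ->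
  measurable_fun setT
    (fun x => (conj_poisson_int y g x ^+ 2 + poisson_int y g x ^+ 2)%:E) /\
  (\int[mu]_x (conj_poisson_int y g x ^+ 2 + poisson_int y g x ^+ 2)%:E <=
   (2 * pi ^+ 2)%:E * \int[mu]_t (g t ^+ 2)%:E)%E.
Proof.
move=> y0 mg ig2.
have mtr n : measurable_fun [set: R] (truncation g n) by exact: measurable_truncation.
have itr2 n : mu.-integrable setT (fun t => (truncation g n t ^+ 2)%:E).
  apply: (@le_integrable _ (measurableTypeR R) _ _ _ measurableT _ _ _ _ ig2).
    by apply/measurable_EFinP; exact: (measurable_funX 2 (mtr n)).
  move=> t _; rewrite /= lee_fin !normrX ler_sqr ?nnegrE//; exact: truncation_le.
have itr n : mu.-integrable setT (EFin \o truncation g n).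
  apply: (@le_integrable _ (measurableTypeR R) _ _ _ measurableT _
    (fun t => ((g t ^+ 2)%:E + (\1_(`[- n%:R, n%:R]%classic) t)%:E)%E)).
  - by apply/measurable_EFinP; exact: (mtr n).
  - move=> t _; rewrite -EFinD /= lee_fin /truncation indicE.
    case: (_ \in _); last by rewrite mulr0 normr0.
    rewrite mulr1 [leRHS]ger0_norm ?addr_ge0 ?sqr_ge0//.
    rewrite -(real_normK (num_real (g t))) mulr1n.
    have := sqr_ge0 (`|g t| - 1); have := normr_ge0 (g t); nra.
  - by apply: integrableD => //; exact: integrable_indic_itv.
pose f n x := (conj_poisson_int y (truncation g n) x ^+ 2 +
               poisson_int y (truncation g n) x ^+ 2)%:E.
have f_cvg x : f n x @[n --> \oo] -->
    (conj_poisson_int y g x ^+ 2 + poisson_int y g x ^+ 2)%:E.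
  apply: cvg_EFin; first by apply: nearW.
  have mq : measurable_fun [set: R] (fun t => conj_poisson y (t - x)).
    by apply: measurable_shift; exact: measurable_conj_poisson.
  have mp : measurable_fun [set: R] (fun t => poisson y (t - x)).
    by apply: measurable_shift; exact: measurable_poisson.
  have cq : conj_poisson_int y (truncation g n) x @[n --> \oo] -->
      conj_poisson_int y g x.
    apply: cvg_integral_truncation => //.
    exact: integrable_mul_conj_poisson.
  have cp : poisson_int y (truncation g n) x @[n --> \oo] --> poisson_int y g x.
    apply: cvg_integral_truncation => //.
    exact: integrable_mul_poisson.
  by apply: cvgD; apply: cvgM.
have mf n : measurable_fun setT (f n).
  have := measurable_fubini_F (integrable_energy y0 (itr n)).
  by congr (measurable_fun _ _); apply/funext => x; exact: integral_energy_plane.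
split; first by apply: (emeasurable_fun_cvg f) => // x _; exact: f_cvg.
have -> : (fun x => (conj_poisson_int y g x ^+ 2 + poisson_int y g x ^+ 2)%:E) =
    (fun x => limn_einf (f ^~ x)).
  by apply/funext => x; rewrite (cvg_limn_einf_sup (f_cvg x)).
apply: (le_trans (@fatou _ _ _ mu _ measurableT f _ _)) => //.
  by move=> n x _; rewrite lee_fin addr_ge0// sqr_ge0.
apply: limn_einf_le => n.
apply: (le_trans (poisson_pair_L2_bound_integrable y0 (itr n) (itr2 n))).
apply: lee_wpmul2l; first by rewrite lee_fin mulr_ge0// sqr_ge0.
apply: ge0_le_integral => //.
- by move=> t _; rewrite lee_fin sqr_ge0.
- by apply/measurable_EFinP; exact: (measurable_funX 2 (mtr n)).
- by apply/measurable_EFinP; exact: (measurable_funX 2 mg).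
- move=> t _; rewrite lee_fin -(real_normK (num_real (truncation g n t))).
  by rewrite -(real_normK (num_real (g t))) ler_sqr ?nnegrE// truncation_le.
Qed.

End square_integrable.

(** * Complex-valued functions *)

Section complex_valued.
Variable R : realType.
Notation mu := (@lebesgue_measure R).
Local Open Scope complex_scope.
Local Notation Re := complex.Re.
Local Notation Im := complex.Im.

(** The squared modulus as a real number, so that no square root and no
    coercion into the complex field enters the integrals. *)
Definition sqnorm (z : R[i]) : R := Re z ^+ 2 + Im z ^+ 2.

Lemma sqnorm_ge0 z : 0 <= sqnorm z.
Proof. by rewrite addr_ge0// sqr_ge0. Qed.

Lemma sqnormM z w : sqnorm (z * w) = sqnorm z * sqnorm w.
Proof. by case: z => a b; case: w => c d; rewrite /sqnorm /=; ring. Qed.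

Lemma sqnormV z : sqnorm z^-1 = (sqnorm z)^-1.
Proof.
have [->|z0] := eqVneq z 0; first by rewrite invr0 /sqnorm /= expr0n addr0 invr0.
have N1 : sqnorm z * sqnorm z^-1 = 1.
  by rewrite -sqnormM divff// /sqnorm /= expr1n expr0n addr0.
have zn0 : sqnorm z != 0.
  by apply/eqP => s0; move: N1; rewrite s0 mul0r => /esym/eqP; rewrite oner_eq0.
by apply: (mulfI zn0); rewrite N1 divff.
Qed.

Lemma L2normE (h : R -> R[i]) :
  L2norm h = ((\int[mu]_x (sqnorm (h x))%:E) `^ 2^-1)%E.
Proof.
rewrite /L2norm unlock; congr (_ `^ _)%E; apply: eq_integral => x _.
rewrite [abse _]/= poweR_EFin; congr EFin; rewrite powR_mulrn// real_normK ?num_real//.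
by case: (h x) => a b; rewrite /sqnorm /= sqr_sqrtr// addr_ge0// sqr_ge0.
Qed.

(** The integral of a nonnegative function is the supremum of the integrals of
    the simple functions below it.  The smaller function will be the squared
    modulus of the Cauchy integral on a line. *)
Lemma ge0_le_integral_nonmeasurable (f1 f2 : R -> \bar R) :
  (forall x, (0 <= f1 x)%E) -> (forall x, (f1 x <= f2 x)%E) ->
  (\int[mu]_x f1 x <= \int[mu]_x f2 x)%E.
Proof.
move=> f10 f12; have f20 x : (0 <= f2 x)%E by rewrite (le_trans (f10 x)).
rewrite !ge0_integralTE//; apply: ereal_sup_le => _ [h hf1 <-].
by exists h => // x; rewrite (le_trans (hf1 x)).
Qed.

Lemma cauchy_kernelE (g : R -> R[i]) (e y x t : R) : 0 < y -> e ^+ 2 = 1 ->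
  g t / (t%:C - (x +i* (e * y))) =
  (Re (g t) * conj_poisson y (t - x) - e * (Im (g t) * poisson y (t - x))) +i*
  (e * (Re (g t) * poisson y (t - x)) + Im (g t) * conj_poisson y (t - x)).
Proof.
move=> y0 e1; have A0 := lt0r_neq0 (sqD_gt0 (t - x) y0).
have w0 : t%:C - (x +i* (e * y)) != 0.
  rewrite eq_complex /= negb_and; apply/orP; right.
  rewrite sub0r oppr_eq0 mulf_neq0 ?(lt0r_neq0 y0)//.
  by apply/eqP => e0; move: e1; rewrite e0 expr0n => /esym/eqP; rewrite oner_eq0.
apply: (mulIf w0); rewrite divfK//; case: (g t) => a b.
have e2 : e * e = 1 by rewrite -expr2.
apply/eqP; rewrite eq_complex /= /conj_poisson /poisson; apply/andP; split; apply/eqP.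
  transitivity (a * (((t - x) ^+ 2 + (e * e) * y ^+ 2) / ((t - x) ^+ 2 + y ^+ 2))).
    by rewrite e2 mul1r divff// mulr1.
  by field.
transitivity (b * (((t - x) ^+ 2 + (e * e) * y ^+ 2) / ((t - x) ^+ 2 + y ^+ 2))).
  by rewrite e2 mul1r divff// mulr1.
by field.
Qed.

Section bound.
Variable g : R -> R[i].
Hypothesis hg : inL2 g.
Let g1 t := Re (g t).
Let g2 t := Im (g t).

Let mg1 : measurable_fun [set: R] g1. Proof. by case: hg => -[]. Qed.
Let mg2 : measurable_fun [set: R] g2. Proof. by case: hg => -[]. Qed.

Let msq : measurable_fun [set: R] (fun t => sqnorm (g t)).
Proof.
by apply: measurable_funD; apply: measurable_funX; [exact: mg1|exact: mg2].
Qed.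

Let isq : mu.-integrable setT (fun t => (sqnorm (g t))%:E).
Proof.
apply/integrableP; split; first exact/measurable_EFinP.
under eq_integral => t _ do rewrite gee0_abs ?lee_fin ?sqnorm_ge0//.
case: hg => _; rewrite L2normE.
by move=> /lty_poweRy; apply; rewrite invr_eq0 gt_eqF.
Qed.

Let ig1 : mu.-integrable setT (fun t => (g1 t ^+ 2)%:E).
Proof.
apply: (@le_integrable _ (measurableTypeR R) _ _ _ measurableT _ _ _ _ isq).
  by apply/measurable_EFinP; exact: (measurable_funX 2 mg1).
move=> t _; rewrite /= lee_fin !ger0_norm ?sqnorm_ge0 ?sqr_ge0//.
by rewrite lerDl sqr_ge0.
Qed.

Let ig2 : mu.-integrable setT (fun t => (g2 t ^+ 2)%:E).
Proof.
apply: (@le_integrable _ (measurableTypeR R) _ _ _ measurableT _ _ _ _ isq).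
  by apply/measurable_EFinP; exact: (measurable_funX 2 mg2).
move=> t _; rewrite /= lee_fin !ger0_norm ?sqnorm_ge0 ?sqr_ge0//.
by rewrite lerDr sqr_ge0.
Qed.

Lemma cauchy_integralE (e y x : R) : 0 < y -> e ^+ 2 = 1 ->
  sqnorm (cauchy_integral g (x +i* (e * y))) =
  (4 * pi ^+ 2)^-1 * ((conj_poisson_int y g1 x - e * poisson_int y g2 x) ^+ 2 +
                      (e * poisson_int y g1 x + conj_poisson_int y g2 x) ^+ 2).
Proof.
move=> y0 e1.
have iq1 := integrable_mul_conj_poisson x y0 mg1 ig1.
have iq2 := integrable_mul_conj_poisson x y0 mg2 ig2.
have ip1 := integrable_mul_poisson x y0 mg1 ig1.
have ip2 := integrable_mul_poisson x y0 mg2 ig2.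
have iZ (h : R -> R) : mu.-integrable setT (fun t => (h t)%:E) ->
   mu.-integrable setT (fun t => (e * h t)%:E).
  by move=> ih; have := integrableZl measurableT e ih.
have -> : cauchy_integral g (x +i* (e * y)) = (2 * (pi : R)%:C * 'i%C)^-1 *
   ((conj_poisson_int y g1 x - e * poisson_int y g2 x) +i*
    (e * poisson_int y g1 x + conj_poisson_int y g2 x)).
  rewrite /cauchy_integral /cintegral; congr (_ * (_ +i* _)).
    under eq_Rintegral do rewrite cauchy_kernelE//=.
    by rewrite RintegralB ?RintegralZl//; exact: iZ.
  under eq_Rintegral do rewrite cauchy_kernelE//=.
  by rewrite RintegralD ?RintegralZl//; exact: iZ.
rewrite sqnormM sqnormV; congr (_^-1 * _).
by rewrite !sqnormM /sqnorm /=; ring.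
Qed.

Lemma L2norm_cauchy_integral (e y : R) : 0 < y -> e ^+ 2 = 1 ->
  (L2norm (fun x => cauchy_integral g (x +i* (e * y)%R)%C) <= L2norm g)%E.
Proof.
move=> y0 e1; rewrite !L2normE.
have C0 : (pi : R) ^+ 2 != 0 by rewrite expf_neq0// lt0r_neq0// pi_gt0.
have N0 (h : R -> R[i]) : (0 <= \int[mu]_x (sqnorm (h x))%:E)%E.
  by apply: integral_ge0 => t _; rewrite lee_fin sqnorm_ge0.
apply: gt0_ler_poweR; rewrite ?in_itv/= ?N0 ?leey ?invr_ge0//.
have [m1 le1] := poisson_pair_L2_bound y0 mg1 ig1.
have [m2 le2] := poisson_pair_L2_bound y0 mg2 ig2.
pose F1 x := (conj_poisson_int y g1 x ^+ 2 + poisson_int y g1 x ^+ 2)%:E.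
pose F2 x := (conj_poisson_int y g2 x ^+ 2 + poisson_int y g2 x ^+ 2)%:E.
have F10 x : (0 <= F1 x)%E by rewrite lee_fin addr_ge0// sqr_ge0.
have F20 x : (0 <= F2 x)%E by rewrite lee_fin addr_ge0// sqr_ge0.
apply: (@le_trans _ _ (\int[mu]_x (((2 * pi ^+ 2)^-1)%R%:E * (F1 x + F2 x))%E)%E).
  apply: ge0_le_integral_nonmeasurable => x; first by rewrite lee_fin sqnorm_ge0.
  rewrite cauchy_integralE// /F1 /F2 -EFinD -EFinM lee_fin.
  have -> : (4 * pi ^+ 2)^-1 = (2 * pi ^+ 2)^-1 / 2 :> R.
    by move: (pi ^+ 2) C0 => C C0; field.
  rewrite -mulrA; apply: ler_wpM2l.
    by rewrite invr_ge0 mulr_ge0// sqr_ge0.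
  rewrite mulrC ler_pdivrMr//.
  set U1 := conj_poisson_int y g1 x; set V1 := poisson_int y g1 x.
  set U2 := conj_poisson_int y g2 x; set V2 := poisson_int y g2 x.
  (* Twice the right-hand sum minus the left-hand one is
     [(U1 + e V2)^2 + (e V1 - U2)^2]. *)
  have <- : e ^+ 2 * V1 ^+ 2 = V1 ^+ 2 by rewrite e1 mul1r.
  have <- : e ^+ 2 * V2 ^+ 2 = V2 ^+ 2 by rewrite e1 mul1r.
  have := sqr_ge0 (U1 + e * V2); have := sqr_ge0 (e * V1 - U2); nra.
rewrite ge0_integralZl_EFin//; last 3 first.
- by move=> x _; rewrite adde_ge0.
- exact: emeasurable_funD.
- by rewrite invr_ge0 mulr_ge0// sqr_ge0.
rewrite ge0_integralD//.
under [leRHS]eq_integral do rewrite EFinD.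
rewrite integralD//.
have I1 : (\int[mu]_t (g1 t ^+ 2)%:E)%E \is a fin_num by exact: integrable_fin_num.
have I2 : (\int[mu]_t (g2 t ^+ 2)%:E)%E \is a fin_num by exact: integrable_fin_num.
apply: (le_trans (lee_wpmul2l _ (leeD le1 le2))).
  by rewrite lee_fin invr_ge0 mulr_ge0// sqr_ge0.
rewrite -(fineK I1) -(fineK I2) -!EFinM -EFinD lee_fin.
rewrite le_eqVlt; apply/orP; left; apply/eqP.
by move: (pi ^+ 2) C0 => C C0; field.
Qed.

End bound.
End complex_valued.

Local Open Scope ereal_scope.

Theorem theorem5p5 (R : realType) (g : R -> R[i]) (hg : inL2 g) :
  ereal_sup [set L2norm (fun x : R => cauchy_integral g (x +i* tau)%C)
            | tau in [set tau : R | (0 < tau)%R]] <= 4%:E * L2norm g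
  /\
  ereal_sup [set L2norm (fun x : R => cauchy_integral g (x -i* tau)%C)
            | tau in [set tau : R | (0 < tau)%R]] <= 4%:E * L2norm g.
Proof.
have le4 : L2norm g <= 4%:E * L2norm g.
  by rewrite -[leLHS]mul1e lee_wpmul2r// ?Lnorm_ge0// lee_fin (ler_nat _ 1 4).
split; apply: ge_ereal_sup => _ [tau tau0 <-]; apply: le_trans le4.
  by rewrite -[tau]mul1r; apply: L2norm_cauchy_integral; rewrite // expr1n.
by rewrite -[tau]mul1r -mulNr; apply: L2norm_cauchy_integral; rewrite // sqrrN expr1n.
Qed.
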